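(* Let $X$ be a finite set. Every regular interval $[U,V]\subseteq\operatorname{Bip}(X)$ is isomorphic to a direct product of Boolean lattices and lattices of the form $\operatorname{Bip}(B)$, where each $B$ is a block both in the ordered bipartition representation of $U$ and in that of $V$, such that $B$ is nonunderlined in $U$ and underlined in $V$.
   Context: A relation $U\subseteq X\times X$ on a finite set $X$ is bipartitional if both $U$ and $(X\times X)\setminus U$ are transitive. $\operatorname{Bip}(X)$ is the set of bipartitional relations on $X$, partially ordered by inclusion. An ordered partition of $X$ is an ordered list $(B_1,\ldots,B_k)$ of pairwise disjoint nonempty subsets (blocks) with union $X$. Every bipartitional relation $U$ on $X$ is represented by a unique pair consisting of an ordered partition $(B_1,\ldots,B_k)$ of $X$ and a vector $(\varepsilon_1,\ldots,\varepsilon_k)\in\{0,1\}^k$ via: $(x,y)\in U$ if and only if either $x\in B_i$, $y\in B_j$ for some $i<j$, or $x,y\in B_i$ for some $i$ with $\varepsilon_i=1$. This pair is the ordered bipartition representation of $U$; the block $B_i$ is underlined if $\varepsilon_i=1$ and nonunderlined if $\varepsilon_i=0$. For a bipartitional relation $U$, write $x\sim_U y$ if either both or none of $(x,y)$ and $(y,x)$ belong to $U$; this is an equivalence relation whose classes are the blocks $B_i$ of $U$. An interval $[U,V]\subseteq\operatorname{Bip}(X)$ is called regular if every $x\in X$ satisfying $(x,x)\in V\setminus U$ also satisfies $\{y\in X: x\sim_U y\}=\{y\in X: x\sim_V y\}$. *)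

(* Defs.v *)
From HB Require Import structures.
From mathcomp Require Import all_boot all_order.

Set Implicit Arguments.
Unset Strict Implicit.
Unset Printing Implicit Defensive.

Import Order.Theory.
(* {set T} is ordered by inclusion. *)
Import Order.DefaultSetSubsetOrder.

(* Binary relations on a finite type T are elements of {set T * T}. *)

Definition transitive_rel (T : finType) (U : {set T * T}) : bool :=
  [forall x, forall y, forall z,
    ((x, y) \in U) ==> ((y, z) \in U) ==> ((x, z) \in U)].

Definition bipartitional (T : finType) (U : {set T * T}) : bool :=
  transitive_rel U && transitive_rel (~: U).

Lemma transitive_relP (T : finType) (U : {set T * T}) :
  reflect (forall x y z, (x, y) \in U -> (y, z) \in U -> (x, z) \in U)
          (transitive_rel U).
Proof.
apply: (iffP forallP) => [tU x y z xyU yzU | tU x].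
  by move/forallP: (tU x) => /(_ y) /forallP /(_ z); rewrite xyU yzU.
apply/forallP => y; apply/forallP => z.
by apply/implyP => xyU; apply/implyP => yzU; apply: tU yzU.
Qed.

Record Bip (T : finType) :=
  MkBip { bip_rel :> {set T * T}; bip_relP : bipartitional bip_rel }.

HB.instance Definition _ (T : finType) := [isSub for @bip_rel T].
HB.instance Definition _ (T : finType) := [Equality of Bip T by <:].
HB.instance Definition _ (T : finType) := [Choice of Bip T by <:].
HB.instance Definition _ (T : finType) := [Countable of Bip T by <:].
HB.instance Definition _ (T : finType) := [Finite of Bip T by <:].

HB.instance Definition _ (T : finType) :=
  [SubChoice_isSubPOrder of Bip T by <: with Order.SetSubsetOrder.subset_display].

Lemma leBipE (T : finType) (U V : Bip T) :
  (U <= V)%O = ((U : {set T * T}) \subset V).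
Proof. by []. Qed.

(* An ordered bipartition is the list [:: (B_1, e_1); ...; (B_k, e_k)]; the   *)
(* block B_i is underlined when e_i = true.                                   *)

Definition ordered_partition (T : finType) (s : seq {set T}) : bool :=
  [&& pairwise (fun A B : {set T} => [disjoint A & B]) s,
      set0 \notin s & \bigcup_(B <- s) B == [set: T]].

Definition block_at (T : finType) (P : seq ({set T} * bool)) (i : nat) :=
  (nth (set0, false) P i).1.

Definition underlined_at (T : finType) (P : seq ({set T} * bool)) (i : nat) :=
  (nth (set0, false) P i).2.

Definition represents (T : finType) (P : seq ({set T} * bool)) (U : Bip T) :
    Prop :=
  ordered_partition (unzip1 P) /\
  forall x y : T, (x, y) \in (U : {set T * T}) <->
    (exists i j, [/\ i < j < size P, x \in block_at P i & y \in block_at P j])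
    \/ (exists i, [/\ i < size P, x \in block_at P i, y \in block_at P i
                    & underlined_at P i]).

(* As the representation of U is unique, the existential quantifier over P    *)
(* selects it.                                                                *)
Definition underlined_block (T : finType) (U : Bip T) (B : {set T}) : Prop :=
  exists2 P, represents P U & (B, true) \in P.

Definition nonunderlined_block (T : finType) (U : Bip T) (B : {set T}) : Prop :=
  exists2 P, represents P U & (B, false) \in P.

Definition sim (T : finType) (U : Bip T) (x y : T) : bool :=
  ((x, y) \in (U : {set T * T})) == ((y, x) \in (U : {set T * T})).

Definition regular_interval (T : finType) (U V : Bip T) : Prop :=
  (U <= V)%O /\
  forall x : T, (x, x) \in (V : {set T * T}) :\: (U : {set T * T}) ->
    [set y | sim U x y] = [set y | sim V x y].

Definition interval (T : finType) (U V : Bip T) : Type :=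
  {W : Bip T | (U <= W <= V)%O}.

HB.instance Definition _ (T : finType) (U V : Bip T) :=
  SubType.copy (interval U V) {W : Bip T | (U <= W <= V)%O}.
HB.instance Definition _ (T : finType) (U V : Bip T) :=
  Finite.copy (interval U V) {W : Bip T | (U <= W <= V)%O}.
HB.instance Definition _ (T : finType) (U V : Bip T) :=
  [SubChoice_isSubPOrder of interval U V by <:
    with Order.SetSubsetOrder.subset_display].

Lemma leintervalE (T : finType) (U V : Bip T) (W W' : interval U V) :
  (W <= W')%O = (val W <= val W')%O.
Proof. by []. Qed.

(* Direct product of a finite family of posets, ordered componentwise.        *)
Definition dprod (d : Order.disp_t) (I : finType) (L : I -> porderType d) :
    Type :=
  {dffun forall i, L i}.

Section DirectProduct.
Variables (d : Order.disp_t) (I : finType) (L : I -> porderType d).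

HB.instance Definition _ :=
  Choice.copy (dprod L) {dffun forall i, (L i : choiceType)}.

Definition le_dprod : rel (dprod L) := fun f g => [forall i, (f i <= g i)%O].

Lemma le_dprod_refl : reflexive le_dprod.
Proof. by move=> f; apply/forallP. Qed.

Lemma le_dprod_anti : antisymmetric le_dprod.
Proof.
move=> f g /andP[/forallP fg /forallP gf]; apply/ffunP => i.
by apply: le_anti; rewrite fg gf.
Qed.

Lemma le_dprod_trans : transitive le_dprod.
Proof.
move=> g f h /forallP fg /forallP gh; apply/forallP => i.
exact: le_trans (fg i) (gh i).
Qed.

HB.instance Definition _ :=
  Order.Le_isPOrder.Build d (dprod L)
    le_dprod_refl le_dprod_anti le_dprod_trans.

End DirectProduct.

Definition poset_isomorphic (d1 d2 : Order.disp_t) (P : porderType d1)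
    (Q : porderType d2) : Prop :=
  exists2 f : P -> Q, bijective f & {mono f : x y / (x <= y)%O}.

Definition boolean_product (m : nat) (n : 'I_m -> nat) :=
  dprod (fun i : 'I_m => {set 'I_(n i)} : porderType _).

Definition Bip_product (T : finType) (S : {set {set T}}) :=
  dprod (fun B : {B : {set T} | B \in S} =>
           Bip {x : T | x \in val B} : porderType _).

(* Main.v *)
(* Regularity forces a pair (x, y) of U whose reverse lies in V to link       *)
(* underlined points of U. Hence "(x, y) in U and (y, x) not in V" is a       *)
(* strict weak order, which every W in [U, V] contains. Its incomparability   *)
(* classes are the common blocks of U and V that are nonunderlined in U and   *)
(* underlined in V, the underlined blocks of V made of underlined blocks of   *)
(* U, and the nonunderlined blocks of U made of nonunderlined blocks of V. A  *)
(* relation W in [U, V] amounts to an independent choice inside each class:   *)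
(* any bipartitional relation on a class of the first kind, and the set of    *)
(* merged (resp. separated) consecutive blocks of the finer partition on a    *)
(* class of the second (resp. third) kind.                                    *)

Require Import Defs.
From mathcomp Require Import all_boot all_order.
From mathcomp Require Import zify.

Set Implicit Arguments.
Unset Strict Implicit.
Unset Printing Implicit Defensive.

(** The asymmetric part of a bipartitional relation is a strict weak order, which [rank] turns into
    a natural number. Two ranks control a regular interval. [rho], the rank of [glue], records the
    comparisons forced on every relation of the interval; [sigma], the rank of [fine], refines it.
    That [glue] and [fine] are bipartitional is where regularity enters, through [regular_rev]. On
    one [rho]-class all points have the same diagonal status in [U] and in [V], which leaves three
    kinds of class. If the points are underlined in [U], the [sigma]-levels are the blocks of [U],
    and a relation of the interval may only merge neighbouring ones. If they are nonunderlined in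
    [V], the levels are the blocks of [V], and it may only separate neighbouring ones. Otherwise [U]
    is empty and [V] is full on the class, so every bipartitional relation is allowed; such a class
    is a common block of [U] and [V]. [interval_bipP] expresses membership in the interval by these
    local conditions. [cuts] reads the merge or separation bits off a relation, [bip_restr] reads
    its restrictions to the special blocks, and [glued] rebuilds the relation. [cuts_glued],
    [gluedB] and [glued_cuts] make these maps mutually inverse, and both directions are monotone. *)

Section Rank.
Variables (T : finType) (R : {set T * T}).
Hypothesis bipR : bipartitional R.

Lemma bip_trans x y z : (x, y) \in R -> (y, z) \in R -> (x, z) \in R.
Proof. by case/andP: bipR => /transitive_relP tR _; apply: tR. Qed.

Lemma bip_split y x z : (x, z) \in R -> ((x, y) \in R) || ((y, z) \in R).
Proof.
case/andP: bipR => _ /transitive_relP tR xz; apply/norP => -[xy yz].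
by have := tR x y z; rewrite !inE => /(_ xy yz); rewrite xz.
Qed.

(** Counts the points strictly below [x]; it grows along the ordered blocks and is constant on each,
    though its values need not be consecutive. *)
Definition rank x := #|[set z | ((z, x) \in R) && ((x, z) \notin R)]|.

Lemma rank_lt x y : (rank x < rank y) = ((x, y) \in R) && ((y, x) \notin R).
Proof.
apply/idP/andP => [|[xy nyx]]; last first.
  apply/proper_card/properP; split; last first.
    by exists x; rewrite !inE ?xy ?nyx // andbN.
  apply/subsetP => z; rewrite !inE => /andP[zx nxz].
  rewrite (bip_trans zx xy); apply: contra nxz => yz.
  exact: bip_trans xy yz.
move=> lt_xy; apply/andP; apply: contraLR lt_xy => nlt; rewrite -leqNgt.
apply/subset_leq_card/subsetP => z; rewrite !inE => /andP[zy nyz].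
have [xy|nxy] := boolP ((x, y) \in R); last first.
  have zx : (z, x) \in R by have := bip_split x zy; rewrite (negPf nxy) orbF.
  by rewrite zx; apply: contra nxy => xz; apply: bip_trans xz zy.
have yx : (y, x) \in R by move: nlt; rewrite xy negbK.
rewrite (bip_trans zy yx); apply: contra nyz => xz; exact: bip_trans yx xz.
Qed.

Lemma rank_eq x y : (rank x == rank y) = (((x, y) \in R) == ((y, x) \in R)).
Proof.
rewrite eqn_leq (leqNgt (rank x)) (leqNgt (rank y)) !rank_lt.
by case: ((x, y) \in R); case: ((y, x) \in R).
Qed.

Lemma rank_leq_card x : rank x <= #|T|.
Proof. exact: max_card. Qed.

End Rank.

(** * The ordered bipartition representation, built from ranks *)

Section Representation.
Variables (T : finType) (U : Bip T).
Local Notation rk := (rank U).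

Lemma representsE : exists2 P, represents P U &
  forall x, ([set y | rk y == rk x], (x, x) \in (U : {set T * T})) \in P.
Proof.
have bU := bip_relP U.
(* Only the rank values that occur are kept, so that no block is empty; increasing order of values
   is the order of the blocks. *)
pose ks := [seq k <- iota 0 #|T|.+1 | [exists x, rk x == k]].
pose P := [seq ([set y | rk y == k],
                [exists x, (rk x == k) && ((x, x) \in (U : {set T * T}))])
          | k <- ks].
have rk_ks x : rk x \in ks.
  rewrite mem_filter mem_iota /= add0n ltnS rank_leq_card andbT.
  by apply/existsP; exists x.
have ks_sorted : sorted ltn ks.
  by apply: sorted_filter; [apply: ltn_trans | apply: iota_ltn_sorted].
have szP : size P = size ks by rewrite size_map.
have blockE i x : i < size P -> (x \in block_at P i) = (rk x == nth 0 ks i).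
  by rewrite szP => iP; rewrite /block_at (nth_map 0) // inE.
have underE i x : i < size P -> rk x = nth 0 ks i ->
    underlined_at P i = ((x, x) \in (U : {set T * T})).
  rewrite szP => iP xi; rewrite /underlined_at (nth_map 0) //=.
  apply/existsP/idP => [[y /andP[/eqP yi yy]]|xx]; last first.
    by exists x; rewrite xi eqxx.
  have := rank_eq bU x y; rewrite xi yi eqxx => /esym/eqP xy.
  have yx : (y, x) \in (U : {set T * T}).
    by have := bip_split bU x yy; rewrite xy orbb.
  by apply: (bip_trans bU _ yx); rewrite xy.
have idxE x : nth 0 ks (index (rk x) ks) = rk x by rewrite nth_index.
have idxP x : index (rk x) ks < size P by rewrite szP index_mem.
exists P; last first.
  move=> x; apply/mapP; exists (rk x) => //; congr (_, _).
  rewrite -(underE _ _ (idxP x)) ?idxE // /underlined_at (nth_map 0) -?szP //=.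
  by rewrite idxE.
split.
  apply/and3P; split.
  - rewrite /P /unzip1 -map_comp pairwise_map.
    have : pairwise ltn ks by rewrite -sorted_pairwise; [|exact: ltn_trans].
    apply: sub_pairwise => i j ij /=; rewrite -setI_eq0.
    apply/eqP/setP => z; rewrite !inE; apply/negP => /andP[]; lia.
  - apply/mapP => -[_ /mapP[k kks ->]] /= /esym/setP k0.
    by move: kks; rewrite mem_filter => /andP[/existsP[x xk]] _;
      have := k0 x; rewrite !inE xk.
  - rewrite eqEsubset subsetT; apply/subsetP => x _.
    rewrite /P /unzip1 -map_comp big_map.
    by rewrite (big_rem (rk x)) ?rk_ks //= !inE eqxx.
have rk_le_idx x y : rk x < rk y -> index (rk x) ks < index (rk y) ks.
  move=> lt_xy; rewrite ltnNge leq_eqVlt; apply/norP; split.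
    apply: contraTN lt_xy => /eqP eq_idx.
    by rewrite -(idxE x) -(idxE y) eq_idx ltnn.
  apply: contraTN lt_xy => lt_idx; rewrite -leqNgt ltnW //.
  by apply: (sorted_ltn_index ltn_trans ks_sorted).
move=> x y; split=> [xy|].
  have [lt_xy|le_yx] := ltnP (rk x) (rk y).
    left; exists (index (rk x) ks), (index (rk y) ks).
    by rewrite !blockE // !idxE !eqxx idxP andbT rk_le_idx.
  have eq_xy : rk x = rk y.
    apply/eqP; rewrite eqn_leq le_yx andbT leqNgt rank_lt // xy.
    by rewrite andbF.
  have yx : (y, x) \in (U : {set T * T}).
    by have := rank_eq bU x y; rewrite eq_xy eqxx xy => /esym/eqP.
  right; exists (index (rk x) ks); rewrite !blockE // (underE _ x) //.
  by rewrite !idxE eq_xy eqxx; split=> //; apply: (bip_trans bU) xy yx.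
case=> [[i [j [/andP[ij jP]]]]|[i [iP]]].
  rewrite !blockE ?(ltn_trans ij) // => /eqP xi /eqP yj.
  suff: rk x < rk y by rewrite rank_lt // => /andP[].
  rewrite xi yj; apply: (sorted_ltn_nth ltn_trans) => //.
    by rewrite inE -szP (ltn_trans ij).
  by rewrite inE -szP.
rewrite !blockE // => /eqP xi /eqP yi; rewrite (underE _ x) // => xx.
have := rank_eq bU x y; rewrite xi yi eqxx => /esym/eqP xy.
by have := bip_split bU y xx; rewrite -xy orbb.
Qed.

End Representation.

Lemma sim_block_mem (T : finType) (U : Bip T) x :
  if (x, x) \in (U : {set T * T}) then underlined_block U [set y | sim U x y]
  else nonunderlined_block U [set y | sim U x y].
Proof.
have [P reprP memP] := representsE U.
have -> : [set y | sim U x y] = [set y | rank U y == rank U x].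
  by apply/setP => y; rewrite !inE (rank_eq (bip_relP U)) eq_sym.
by have := memP x; case: ifP => _ xP; exists P.
Qed.

(** A failure of either transitivity cannot spread over several fibres: related pairs never decrease
    [r] and unrelated pairs never increase it, so only triples with constant [r] need a check. *)
Lemma bipartitional_fibres (T : finType) (r : T -> nat) (R : {set T * T}) :
  (forall x y, r x < r y -> ((x, y) \in R) && ((y, x) \notin R)) ->
  (forall x y z, r x = r y -> r y = r z ->
     (x, y) \in R -> (y, z) \in R -> (x, z) \in R) ->
  (forall x y z, r x = r y -> r y = r z ->
     (x, y) \notin R -> (y, z) \notin R -> (x, z) \notin R) ->
  bipartitional R.
Proof.
move=> ltR trR trC.
have leR x y : (x, y) \in R -> r x <= r y.
  by apply: contraTT; rewrite -ltnNge => /ltR /andP[].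
have leC x y : (x, y) \notin R -> r y <= r x.
  by apply: contraNT; rewrite -ltnNge => /ltR /andP[].
apply/andP; split; apply/transitive_relP => x y z; rewrite ?inE => xy yz.
  have [xz|zx|eq_xz] := ltngtP (r x) (r z); first by case/andP: (ltR _ _ xz).
    by have := leR _ _ xy; have := leR _ _ yz; lia.
  by apply: (trR _ y) => //; have := leR _ _ xy; have := leR _ _ yz; lia.
have [xz|zx|eq_xz] := ltngtP (r x) (r z); last 1 first.
- by apply: (trC _ y) => //; have := leC _ _ xy; have := leC _ _ yz; lia.
- by have := leC _ _ xy; have := leC _ _ yz; lia.
by case/andP: (ltR _ _ zx).
Qed.

Section Restriction.
Variables (T : finType) (B : {set T}) (W : Bip T).

Let R : {set {x | x \in B} * {x | x \in B}} :=
  [set p | (val p.1, val p.2) \in (W : {set T * T})].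

Fact bip_restr_subproof : bipartitional R.
Proof.
apply/andP; split; apply/transitive_relP => x y z; rewrite !inE /=.
  exact: (bip_trans (bip_relP W)).
move=> xy yz; apply/negP => /(bip_split (bip_relP W) (val y)).
exact/negP/norP.
Qed.

Definition bip_restr := MkBip bip_restr_subproof.

Lemma bip_restrE x y :
  ((x, y) \in bip_rel bip_restr) = ((val x, val y) \in bip_rel W).
Proof. by rewrite inE. Qed.

End Restriction.

(** * The coarse and fine weak orders of a regular interval *)

Section RegularInterval.
Variables (X : finType) (U V : Bip X).
Hypothesis hUV : regular_interval U V.

Local Notation u x y := ((x, y) \in bip_rel U).
Local Notation v x y := ((x, y) \in bip_rel V).
Local Notation special x := (v x x && ~~ u x x).

Let u_trans := bip_trans (bip_relP U).
Let v_trans := bip_trans (bip_relP V).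
Let u_split := bip_split (bip_relP U).
Let v_split := bip_split (bip_relP V).

Lemma uv x y : u x y -> v x y.
Proof. by have [/subsetP sUV _] := hUV; apply: sUV. Qed.

Lemma special_sim x y : special x -> sim U x y = sim V x y.
Proof.
have [_ reg] := hUV; move=> spx; have := reg x; rewrite !inE andbC.
by move=> /(_ spx)/setP/(_ y); rewrite !inE.
Qed.

(** Here [x] and [y] share an underlined block of [V]. If one of them were nonunderlined in [U],
    regularity would put both in one block of [U], and [u x y] would then make that block
    underlined. *)
Lemma regular_rev x y : u x y -> v y x -> u x x && u y y.
Proof.
move=> uxy vyx; have vxy := uv uxy.
have sim_rev z t : sim V z t -> v z z -> u z t || u t z -> u z z.
  move=> simV vzz uzt; apply/negPn/negP => nuzz.
  move: simV; rewrite -special_sim ?vzz // => /eqP sUzt.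
  have uzt' : u z t by move: uzt; rewrite -sUzt orbb.
  by case/negP: nuzz; apply: (u_trans uzt'); rewrite -sUzt.
rewrite (sim_rev x y) ?(sim_rev y x) ?uxy ?orbT //.
- by rewrite /sim vyx vxy.
- exact: v_trans vyx vxy.
- by rewrite /sim vyx vxy.
- exact: v_trans vxy vyx.
Qed.

Definition glue : {set X * X} := [set p | u p.1 p.2 && ~~ v p.2 p.1].
(** Unlike [glue], this can hold in both directions: it contains every pair of points of a common
    block that is nonunderlined in [U] and underlined in [V]. *)
Definition fine : {set X * X} := [set p | v p.1 p.2 && ~~ u p.2 p.1].

Lemma glue_bip : bipartitional glue.
Proof.
apply/andP; split; apply/transitive_relP => x y z; rewrite !inE /=.
  move=> /andP[uxy nvyx] /andP[uyz nvzy]; rewrite (u_trans uxy uyz) /=.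
  by apply: contra nvyx => vzx; apply: v_trans (uv uyz) vzx.
move=> nxy nyz; apply/negP => /andP[uxz /negP nvzx]; apply: nvzx.
have /orP[uxy|uyz] := u_split y uxz.
  have vyx : v y x by move: nxy; rewrite uxy negbK.
  (* Once [y] is underlined in [U], it is comparable in [U] with every point, which decides the
     remaining pair. *)
  have /andP[_ uyy] := regular_rev uxy vyx.
  apply: v_trans vyx; have /orP[uyz|/uv//] := u_split z uyy.
  by move: nyz; rewrite uyz negbK.
have vzy : v z y by move: nyz; rewrite uyz negbK.
have /andP[uyy _] := regular_rev uyz vzy.
apply: (v_trans vzy); have /orP[/uv//|uxy] := u_split x uyy.
by move: nxy; rewrite uxy negbK.
Qed.

Lemma fine_bip : bipartitional fine.
Proof.
apply/andP; split; apply/transitive_relP => x y z; rewrite !inE /=.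
  move=> /andP[vxy nuyx] /andP[vyz nuzy]; rewrite (v_trans vxy vyz) /=.
  by apply/negP => /(u_split y); apply/negP/norP.
move=> nxy nyz; apply/negP => /andP[vxz /negP nuzx]; apply: nuzx.
have uyx : v x y -> u y x by move=> vxy; move: nxy; rewrite vxy negbK.
have uzy : v y z -> u z y by move=> vyz; move: nyz; rewrite vyz negbK.
have /orP[vxy|vyz] := v_split y vxz.
  have /andP[uyy _] := regular_rev (uyx vxy) vxy.
  apply: u_trans (uyx vxy); have /orP[uyz|//] := u_split z uyy.
  exact/uzy/uv.
have /andP[_ uyy] := regular_rev (uzy vyz) vyz.
apply: (u_trans (uzy vyz)); have /orP[//|uxy] := u_split x uyy.
exact/uyx/uv.
Qed.

Local Notation rho := (rank glue).
Local Notation sigma := (rank fine).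

Lemma rho_lt x y : (rho x < rho y) = u x y && ~~ v y x.
Proof.
rewrite (rank_lt glue_bip) !inE /= andb_idr // => /andP[uxy _].
by rewrite (uv uxy) andbF.
Qed.

Lemma sigma_lt x y :
  (sigma x < sigma y) = v x y && ~~ u y x && ~~ (v y x && ~~ u x y).
Proof. by rewrite (rank_lt fine_bip) !inE. Qed.

Lemma rho_lt_sigma x y : rho x < rho y -> sigma x < sigma y.
Proof.
rewrite rho_lt sigma_lt => /andP[uxy nvyx].
by rewrite (uv uxy) (negPf nvyx) (contra (@uv _ _) nvyx).
Qed.

Lemma rho_le_sigma x y : sigma x <= sigma y -> rho x <= rho y.
Proof. by apply: contraTT; rewrite -!ltnNge => /rho_lt_sigma. Qed.

(** [sigma] refines [rho], so each [rho]-class is convex for [sigma]. *)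
Lemma rho_between x y z :
  rho x = rho y -> sigma x < sigma z <= sigma y -> rho z = rho x.
Proof.
move=> rxy /andP[lt_xz le_zy]; apply/eqP.
by rewrite eqn_leq {1}rxy !rho_le_sigma // ltnW.
Qed.

Lemma rho_eq_rev x y : rho x = rho y -> u x y -> v y x.
Proof.
move=> rxy uxy; have := rho_lt x y.
by rewrite rxy ltnn uxy => /esym/negbFE.
Qed.

Lemma rho_eq_u x y : rho x = rho y -> u x x -> u y y.
Proof.
move=> rxy uxx; have /orP[uxy|uyx] := u_split y uxx.
  by have /andP[] := regular_rev uxy (rho_eq_rev rxy uxy).
by have /andP[] := regular_rev uyx (rho_eq_rev (esym rxy) uyx).
Qed.

(** On a special class [U] is empty and [V] is full, so the interval imposes nothing there; this is
    the source of the factors [Bip(B)]. *)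
Lemma rho_eq_special_sim x y : rho x = rho y -> special x -> ~~ u x y && v x y.
Proof.
move=> rxy spx; have /andP[vxx nuxx] := spx.
have nuxy : ~~ u x y.
  apply: contra nuxx => uxy.
  by case/andP: (regular_rev uxy (rho_eq_rev rxy uxy)).
have nuyx : ~~ u y x.
  apply: contra nuxx => uyx.
  by case/andP: (regular_rev uyx (rho_eq_rev (esym rxy) uyx)).
have := special_sim y spx; rewrite /sim (negPf nuxy) (negPf nuyx) eqxx.
move=> /esym/eqP vE; have := v_split y vxx.
by rewrite -vE orbb => ->.
Qed.

Lemma rho_eq_v x y : rho x = rho y -> v x x -> v y y.
Proof.
move=> rxy vxx; have [uxx|nuxx] := boolP (u x x).
  exact/uv/(rho_eq_u rxy).
have spx : special x by rewrite vxx.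
have /andP[nuxy vxy] := rho_eq_special_sim rxy spx.
have /eqP vE : sim V x y.
  rewrite -special_sim // /sim (negPf nuxy); apply/eqP; apply/esym/negP => uyx.
  have := regular_rev uyx vxy; rewrite (negPf nuxx) andbF //.
by apply: (v_trans _ vxy); rewrite -vE.
Qed.

Lemma rho_eq_special x y : rho x = rho y -> special x -> special y.
Proof.
move=> rxy /andP[vxx nuxx]; rewrite (rho_eq_v rxy vxx) /=.
by apply: contra nuxx; apply: rho_eq_u.
Qed.

(** On an underlined class [U] is the weak order of [sigma], the least relation allowed there;
    [v_sigma] is the dual fact for the greatest relation on a nonunderlined class. *)
Lemma u_sigma x y : rho x = rho y -> u x x -> (u x y) = (sigma x <= sigma y).
Proof.
move=> rxy uxx; rewrite leqNgt sigma_lt.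
have [uyx|nuyx] := boolP (u y x).
  by rewrite (uv uyx) (rho_eq_rev (esym rxy) uyx) /= andbT negbK.
have := u_split y uxx; rewrite (negPf nuyx) orbF => uxy.
by rewrite uxy andbF.
Qed.

Lemma v_sigma x y : rho x = rho y -> ~~ v x x -> v x y = (sigma x < sigma y).
Proof.
move=> rxy nvxx; rewrite sigma_lt.
have nuxy : ~~ u x y.
  apply: contra nvxx => uxy; exact: v_trans (uv uxy) (rho_eq_rev rxy uxy).
have nuyx : ~~ u y x.
  apply: contra nvxx => uyx.
  exact: v_trans (rho_eq_rev (esym rxy) uyx) (uv uyx).
rewrite nuxy nuyx !andbT; case vxy : (v x y) => //=; apply/esym.
by apply: contra nvxx; apply: v_trans.
Qed.

Lemma sim_special x : special x ->
  [set y | sim U x y] = [set y | rho y == rho x] /\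
  [set y | sim V x y] = [set y | rho y == rho x].
Proof.
move=> spx; suff simE y : sim U x y = (rho y == rho x).
  split; apply/setP => y; rewrite !inE // -special_sim //.
rewrite eq_sym (rank_eq glue_bip) !inE /=.
have := special_sim y spx; rewrite /sim.
have := @uv x y; have := @uv y x.
case: (u x y); case: (u y x); case: (v x y); case: (v y x) => //=.
all: try by move=> /(_ isT).
all: try by move=> _ /(_ isT).
Qed.

Section Membership.
Variable W : Bip X.
Local Notation w x y := ((x, y) \in bip_rel W).

(** Splits the two inclusions by [rho]-class: across classes everything is forced, an underlined
    class only has the lower bound [U], a nonunderlined one only the upper bound [V], and a special
    class has no constraint. *)
Lemma interval_bipP :
  reflect (forall x y, [/\ rho x < rho y -> w x y && ~~ w y x,
       rho x = rho y -> u x x -> sigma x <= sigma y -> w x y &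
       rho x = rho y -> ~~ v x x -> sigma x <= sigma y -> ~~ w y x])
    (U <= W <= V)%O.
Proof.
rewrite !leBipE; apply: (iffP andP) => [[/subsetP sUW /subsetP sWV] x y|cW].
  split.
  - rewrite rho_lt => /andP[uxy nvyx]; rewrite (sUW (x, y)) //=.
    by apply: contra nvyx; apply: sWV.
  - by move=> rxy uxx; rewrite -u_sigma //; apply: sUW.
  - move=> rxy nvxx le_xy; apply/negP => /sWV; apply/negP.
    rewrite v_sigma //; last first.
      by apply: contra nvxx; apply: rho_eq_v.
    by rewrite -leqNgt.
split; apply/subsetP => -[x y] /= xy; have [ltW1 ord1 ord0] := cW x y;
  have [ltW1' ord1' ord0'] := cW y x;
  have [lt_xy|lt_yx|eq_xy] := ltngtP (rho x) (rho y).
- by case/andP: (ltW1 lt_xy).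
- by move: lt_yx; rewrite rho_lt (uv xy) andbF.
- have uxx : u x x.
    by case/andP: (regular_rev xy (rho_eq_rev eq_xy xy)).
  by apply: ord1; rewrite -?u_sigma.
- by move: lt_xy; rewrite rho_lt => /andP[/uv].
- by case/andP: (ltW1' lt_yx); rewrite xy.
have [vxx|nvxx] := boolP (v x x); last first.
  rewrite v_sigma // ltnNge; apply: contraL xy => le_yx.
  apply: ord0' => //; apply: contra nvxx; exact: rho_eq_v.
have [uxx|nuxx] := boolP (u x x).
  have /orP[/uv//|uyx] := u_split y uxx.
  exact: rho_eq_rev uyx.
have spx : special x by rewrite vxx.
by have /andP[] := rho_eq_special_sim eq_xy spx.
Qed.

End Membership.

(** Representatives of two consecutive [sigma]-levels in one nonspecial [rho]-class. No point [z] of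
    any class may lie between, which by convexity is the same as none of that class. *)
Definition cover (p : X * X) : bool :=
  [&& rho p.1 == rho p.2, u p.2 p.2 || ~~ v p.2 p.2, sigma p.1 < sigma p.2 &
    [forall z, ~~ (sigma p.1 < sigma z < sigma p.2)]].

Lemma covers_enum : exists n (c : 'I_n -> X * X),
  [/\ forall i, cover (c i), injective (fun i => sigma (c i).2) &
   forall x y, u y y || ~~ v y y -> rho x = rho y -> sigma x < sigma y ->
     exists i, sigma (c i).2 = sigma y].
Proof.
(* A cut is indexed by the [sigma]-value of its upper level, so that the many pairs representing one
   cut count once. *)
pose Y := [set k : 'I_#|X|.+1 | [exists p, cover p && (sigma p.2 == k)]].
have /fin_all_exists[c cP] (i : 'I_#|Y|) :
    exists p, cover p && (sigma p.2 == enum_val i).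
  by apply/existsP; have := enum_valP i; rewrite inE.
exists #|Y|, c; split=> [i | i j eq_ij | x y nsy rxy lt_xy].
- by case/andP: (cP i).
- apply/enum_val_inj/val_inj => /=.
  by have /andP[_ /eqP <-] := cP i; have /andP[_ /eqP <-] := cP j.
(* The lower end is a point [t] of the highest level below [y]; lying between [x] and [y], it stays
   in their [rho]-class. *)
case: (@arg_maxnP _ x (fun t => sigma t < sigma y) sigma lt_xy) => t lt_ty maxt.
have rty : rho t = rho y.
  apply/eqP; rewrite eqn_leq (rho_le_sigma (ltnW lt_ty)) -rxy.
  exact/rho_le_sigma/maxt.
have cov_ty : cover (t, y).
  rewrite /cover /= rty eqxx nsy lt_ty; apply/forallP => z.
  apply/negP => /andP[lt_tz /maxt le_zt].
  by have := leq_trans lt_tz le_zt; rewrite ltnn.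
have le_y : sigma y < #|X|.+1 by rewrite ltnS rank_leq_card.
have Yy : Ordinal le_y \in Y.
  by rewrite inE; apply/existsP; exists (t, y); rewrite cov_ty /=.
pose i := enum_rank_in Yy (Ordinal le_y); exists i.
by have /andP[_ /eqP ->] := cP i; rewrite enum_rankK_in.
Qed.

Definition special_blocks : {set {set X}} :=
  [set [set y | rho y == rho x] | x in [set x | special x]].

Lemma special_block_special (B : {set X}) x :
  B \in special_blocks -> x \in B -> special x.
Proof.
case/imsetP => t; rewrite inE => spt ->; rewrite inE => /eqP xt.
exact: rho_eq_special (esym xt) spt.
Qed.

Lemma special_block_mem (B : {set X}) x y :
  B \in special_blocks -> x \in B -> (y \in B) = (rho x == rho y).
Proof.
by case/imsetP => t _ ->; rewrite !inE => /eqP ->; rewrite eq_sym.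
Qed.

Lemma special_block_ex x : special x ->
  exists2 B, B \in special_blocks & x \in B.
Proof.
move=> spx; exists [set y | rho y == rho x]; last by rewrite inE.
by apply/imsetP; exists x; rewrite ?inE.
Qed.

(** * Coordinates on the interval: cut bits and restrictions to special blocks *)

Section Coordinates.
Variables (n : nat) (c : 'I_n -> X * X).
Hypothesis c_cover : forall i, cover (c i).
Hypothesis c_inj : injective (fun i => sigma (c i).2).
Hypothesis c_surj : forall x y, u y y || ~~ v y y -> rho x = rho y ->
  sigma x < sigma y -> exists i, sigma (c i).2 = sigma y.

Local Notation S := special_blocks.
Local Notation a i := (c i).1.
Local Notation b i := (c i).2.
Local Notation blockT := {B : {set X} | B \in S}.

(* Bit i is set when W merges (underlined case) or separates (nonunderlined  *)
(* case) the two consecutive blocks of a i and b i; both are monotone in W.   *)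
Definition cuts (W : {set X * X}) : {set 'I_n} :=
  [set i | if u (b i) (b i) then (b i, a i) \in W else (a i, b i) \in W].

(** Cut [i] separates two points when [sigma (b i)] lies in the interval between their levels, open
    below and closed above. In an underlined class going down needs all crossed cuts merged; in a
    nonunderlined one going up needs some crossed cut separated. The special case quantifies over
    [B], [s] and [t] to avoid transporting [x] and [y] into a subtype that depends on their
    block. *)
Definition glued (M : {set 'I_n})
    (F : forall B : blockT, Bip {x | x \in val B}) : {set X * X} :=
  [set p | let: (x, y) := p in
    (rho x < rho y) || (rho x == rho y) &&
    if u x x then [forall i, (sigma y < sigma (b i) <= sigma x) ==> (i \in M)]
    else if v x x then
      [exists B : blockT, exists s : {x | x \in val B},
       exists t : {x | x \in val B},
         [&& val s == x, val t == y & (s, t) \in bip_rel (F B)]]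
    else [exists i, (sigma x < sigma (b i) <= sigma y) && (i \in M)]].

Section Glued.
Variables (M : {set 'I_n}) (F : forall B : blockT, Bip {x | x \in val B}).
Local Notation G := (glued M F).

Lemma glued_lt x y : rho x < rho y -> ((x, y) \in G) && ((y, x) \notin G).
Proof.
by move=> lt_xy; rewrite !inE lt_xy (gtn_eqF lt_xy) ltnNge (ltnW lt_xy).
Qed.

Lemma glued1 x y : rho x = rho y -> u x x ->
  ((x, y) \in G) =
  [forall i, (sigma y < sigma (b i) <= sigma x) ==> (i \in M)].
Proof. by move=> rxy uxx; rewrite inE rxy ltnn eqxx uxx. Qed.

Lemma glued0 x y : rho x = rho y -> ~~ v x x ->
  ((x, y) \in G) =
  [exists i, (sigma x < sigma (b i) <= sigma y) && (i \in M)].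
Proof.
move=> rxy nvxx; rewrite inE rxy ltnn eqxx (negPf nvxx) /= ifN //.
exact: contra (@uv _ _) nvxx.
Qed.

Lemma gluedB (B : blockT) (s t : {x | x \in val B}) :
  ((val s, val t) \in G) = ((s, t) \in bip_rel (F B)).
Proof.
have /andP[vss nuss] := special_block_special (valP B) (valP s).
have := valP t; rewrite (special_block_mem _ (valP B) (valP s)) => /eqP rst.
rewrite inE rst ltnn eqxx vss (negPf nuss) /=.
apply/existsP/idP => [[B' /existsP[s' /existsP[t' /and3P[]]]]|st].
  (* Special blocks are [rho]-classes, so two of them sharing a point coincide. *)
  move=> /eqP ss /eqP tt; have eqB : B' = B.
    apply/val_inj/setP => z.
    rewrite (special_block_mem _ (valP B) (valP s)).
    by rewrite (special_block_mem _ (valP B') (valP s')); move: ss => /= ->.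
  subst B'; have -> : s = s' by apply: val_inj.
  by have -> : t = t' by apply: val_inj.
by exists B; apply/existsP; exists s; apply/existsP; exists t; rewrite !eqxx.
Qed.

Lemma rho_special_block x y : rho x = rho y -> special x ->
  exists (B : blockT) (s t : {x | x \in val B}), x = val s /\ y = val t.
Proof.
move=> rxy spx; have [B BS xB] := special_block_ex spx.
have yB : y \in B by rewrite (special_block_mem _ BS xB) rxy.
by exists (Sub B BS), (Sub x xB), (Sub y yB).
Qed.

Lemma glued_bip : bipartitional G.
Proof.
apply: (@bipartitional_fibres _ rho) => [x y|x y z|x y z].
    exact: glued_lt.
  move=> rxy ryz; have rxz := etrans rxy ryz.
  have [uxx|nuxx] := boolP (u x x).
    have uyy := rho_eq_u rxy uxx.
    rewrite !glued1 // => /forallP xy /forallP yz; apply/forallP => i.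
    apply/implyP => /andP[zi ix]; have [yi|iy] := ltnP (sigma y) (sigma (b i)).
      by apply: (implyP (xy i)); rewrite yi.
    by apply: (implyP (yz i)); rewrite zi.
  have [vxx|nvxx] := boolP (v x x); last first.
    have nvyy : ~~ v y y by apply: contra nvxx; apply: rho_eq_v.
    rewrite !glued0 // => /existsP[i /andP[/andP[xi iy] iM]].
    move=> /existsP[j /andP[/andP[yj jz] jM]]; apply/existsP; exists i.
    by rewrite xi iM !andbT (leq_trans iy) // (leq_trans (ltnW yj)).
  have spx : special x by rewrite vxx.
  have [B [s [t [-> yt]]]] := rho_special_block rxy spx.
  have zB : z \in val B
    by rewrite (special_block_mem _ (valP B) (valP t)) -yt ryz.
  rewrite yt (_ : z = val (Sub z zB : {x | x \in val B})) // !gluedB.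
  exact: (bip_trans (bip_relP (F B))).
move=> rxy ryz; have rxz := etrans rxy ryz.
have [uxx|nuxx] := boolP (u x x).
  have uyy := rho_eq_u rxy uxx.
  rewrite !glued1 // => /forallPn[i].
  rewrite negb_imply => /andP[/andP[yi ix] iM].
  move=> /forallPn[j]; rewrite negb_imply => /andP[/andP[zj jy] jM].
  apply/forallPn; exists i; rewrite negb_imply iM ix !andbT.
  by rewrite (leq_ltn_trans _ yi) // (leq_trans (ltnW zj)).
have [vxx|nvxx] := boolP (v x x); last first.
  have nvyy : ~~ v y y by apply: contra nvxx; apply: rho_eq_v.
  rewrite !glued0 // => xy yz; apply/existsP => -[i /andP[/andP[xi iz] iM]].
  have [yi|iy] := ltnP (sigma y) (sigma (b i)).
    by case/existsP: yz; exists i; rewrite yi iz.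
  by case/existsP: xy; exists i; rewrite xi iy.
have spx : special x by rewrite vxx.
have [B [s [t [-> yt]]]] := rho_special_block rxy spx.
have zB : z \in val B
    by rewrite (special_block_mem _ (valP B) (valP t)) -yt ryz.
rewrite yt (_ : z = val (Sub z zB : {x | x \in val B})) // !gluedB.
move=> nst ntz; apply/negP => /(bip_split (bip_relP (F B)) t).
exact/negP/norP.
Qed.

Lemma glued_interval : (U <= MkBip glued_bip <= V)%O.
Proof.
apply/interval_bipP => x y; split.
- exact: glued_lt.
- move=> rxy uxx le_xy; rewrite /= glued1 //; apply/forallP => i.
  by apply/implyP => /andP[lt_yi]; rewrite leqNgt (leq_ltn_trans le_xy).
move=> rxy nvxx le_xy; rewrite /= glued0 //; last first.
  by apply: contra nvxx; apply: rho_eq_v.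
apply/existsP => -[i /andP[/andP[lt_yi]]].
by rewrite leqNgt (leq_ltn_trans le_xy).
Qed.

(** A step between consecutive levels crosses exactly its own cut, so membership of the pair [c i]
    in a glued relation reads off the single bit [i]. *)
Lemma cover_between i j :
  (sigma (a i) < sigma (b j) <= sigma (b i)) = (j == i).
Proof.
have /and4P[_ _ lt_ab /forallP noz] := c_cover i.
apply/andP/eqP => [[lt_aj]|->]; last by rewrite lt_ab leqnn.
rewrite leq_eqVlt => /predU1P[/c_inj //|lt_ji].
by have := noz (b j); rewrite lt_aj lt_ji.
Qed.

Lemma cuts_glued : cuts G = M.
Proof.
apply/setP => i; rewrite inE.
have /and4P[/eqP rab nsb _ _] := c_cover i.
have [ubb|nubb] := boolP (u (b i) (b i)).
  rewrite glued1 //; apply/forallP/idP => [/(_ i)|iM j]; rewrite cover_between.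
    by rewrite eqxx.
  by apply/implyP => /eqP ->.
have nvbb : ~~ v (b i) (b i) by move: nsb; rewrite (negPf nubb).
rewrite glued0 //; last by apply: contra nvbb; apply: rho_eq_v.
apply/existsP/idP => [[j]|iM]; last by exists i; rewrite cover_between eqxx.
by rewrite cover_between => /andP[/eqP ->].
Qed.

End Glued.

Lemma glued_mono (M M' : {set 'I_n})
    (F F' : forall B : blockT, Bip {x | x \in val B}) :
  M \subset M' ->
    (forall B, bip_rel (F B) \subset bip_rel (F' B)) ->
  glued M F \subset glued M' F'.
Proof.
move=> /subsetP sM sF; apply/subsetP => -[x y].
rewrite !inE => /orP[->//|/andP[-> cxy]]; apply/orP; right; move: cxy.
case: ifP => _; last case: ifP => _ /=.
- move=> /forallP xy; apply/forallP => i.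
  by apply/implyP => /(implyP (xy i)); apply: sM.
- case/existsP => B /existsP[s /existsP[t /and3P[sx ty st]]].
  apply/existsP; exists B; apply/existsP; exists s; apply/existsP; exists t.
  by rewrite sx ty (subsetP (sF B)).
by case/existsP => i /andP[xiy iM]; apply/existsP; exists i; rewrite xiy sM.
Qed.

Lemma eq_glued (M : {set 'I_n})
    (F F' : forall B : blockT, Bip {x | x \in val B}) :
  (forall B, F B = F' B) -> glued M F = glued M F'.
Proof.
by move=> eqF; apply/eqP; rewrite eqEsubset !glued_mono // => B; rewrite eqF.
Qed.

Lemma cover_ge i x : sigma x < sigma (b i) -> sigma x <= sigma (a i).
Proof.
have /and4P[_ _ _ /forallP/(_ x)] := c_cover i.
by case: ltnP => //= _ /negPf ->.
Qed.

Lemma cuts_mono (W W' : {set X * X}) : W \subset W' -> cuts W \subset cuts W'.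
Proof.
by move=> /subsetP sW; apply/subsetP => i; rewrite !inE; case: ifP => _ /sW.
Qed.

(** * A relation in the interval is determined by its coordinates *)

Section GluedCuts.
Variable W : Bip X.
Hypothesis WP : (U <= W <= V)%O.
Local Notation w x y := ((x, y) \in bip_rel W).

Let w_trans := bip_trans (bip_relP W).
Let w_split := bip_split (bip_relP W).

Lemma w_cuts1 x y : rho x = rho y -> u x x ->
  w x y = [forall i, (sigma y < sigma (b i) <= sigma x) ==> (i \in cuts W)].
Proof.
move/interval_bipP: WP => cW.
have w_le z t : rho z = rho t -> u z z -> sigma z <= sigma t -> w z t.
  by have [_ + _] := cW z t.
move=> rxy uxx; apply/idP/forallP => [wxy i|].
  apply/implyP => /[dup] yix /andP[lt_yi le_ix].
  have ryi := rho_between (esym rxy) yix.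
  have /and4P[/eqP rab _ _ _] := c_cover i.
  have uyy := rho_eq_u rxy uxx; have ubb := rho_eq_u (esym ryi) uyy.
  rewrite inE ubb.
  have wbx : w (b i) x by apply: w_le; rewrite ?ryi.
  apply: (w_trans wbx); apply: (w_trans wxy); apply: w_le => //.
    by rewrite rab.
  exact: cover_ge.
(* Descent one level at a time: from [x] to the representative [b i] of its level, across the merged
   cut to [a i], and then by induction to [y]. *)
have [k] := ubnP (sigma x); elim: k x rxy uxx => // k IH x rxy uxx.
rewrite ltnS => le_xk allM.
have [le_xy|lt_yx] := leqP (sigma x) (sigma y); first exact: w_le.
have [|i six] := c_surj _ (esym rxy) lt_yx; first by rewrite uxx.
have yix : sigma y < sigma (b i) <= sigma x by rewrite six lt_yx leqnn.
have rbx : rho (b i) = rho x by rewrite rxy (rho_between (esym rxy) yix).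
have ubb := rho_eq_u (esym rbx) uxx.
have /and4P[/eqP rab _ lt_ab _] := c_cover i.
have := implyP (allM i) yix; rewrite inE ubb => wba.
apply: (w_trans (y := b i)); first by apply: w_le => //; rewrite six.
apply: (w_trans wba); apply: IH.
- by rewrite rab rbx.
- exact: rho_eq_u (esym rab) ubb.
- by apply: leq_trans le_xk; rewrite -six.
move=> j; apply/implyP => /andP[lt_yj le_ja]; apply: (implyP (allM j)).
by rewrite lt_yj (leq_trans le_ja) // -six ltnW.
Qed.

Lemma w_cuts0 x y : rho x = rho y -> ~~ v x x ->
  w x y = [exists i, (sigma x < sigma (b i) <= sigma y) && (i \in cuts W)].
Proof.
move/interval_bipP: WP => cW.
have w_ge z t : rho z = rho t -> ~~ v z z -> sigma t <= sigma z -> ~~ w z t.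
  move=> rzt nvzz le_tz; have [_ _ + ] := cW t z; apply=> //.
  by apply: contra nvzz; apply: rho_eq_v.
have nv_eq z t : rho z = rho t -> ~~ v z z -> ~~ v t t.
  by move=> rzt; apply: contra; apply: rho_eq_v.
move=> rxy nvxx; apply/idP/existsP=> [|[i /andP[xiy]]].
  have [k] := ubnP (sigma y); elim: k y rxy => // k IH y rxy.
  rewrite ltnS => le_yk wxy.
  have [le_yx|lt_xy] := leqP (sigma y) (sigma x).
    by move: wxy; rewrite (negPf (w_ge _ _ rxy nvxx le_yx)).
  have nvyy := nv_eq _ _ rxy nvxx.
  have [|i siy] := c_surj _ rxy lt_xy; first by rewrite nvyy orbT.
  have xiy : sigma x < sigma (b i) <= sigma y by rewrite siy lt_xy leqnn.
  have rbx : rho (b i) = rho x by rewrite (rho_between rxy xiy).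
  have /and4P[/eqP rab _ lt_ab _] := c_cover i.
  have nvbb := nv_eq _ _ (esym rbx) nvxx.
  have wxb : w x (b i).
    have /orP[//|wby] := w_split (b i) wxy.
    by move: wby; apply: contraLR => _; apply: w_ge; rewrite ?rbx ?siy.
  (* Either the relation already holds up to the level below, where induction finds a separated cut,
     or the top cut [i] is itself separated. *)
  have /orP[wxa|wab] := w_split (a i) wxb.
    have [||j /andP[/andP[lt_xj le_ja] jM]] := IH (a i) _ _ wxa.
    - by rewrite rab rbx.
    - by apply: leq_trans le_yk; rewrite -siy.
    by exists j; rewrite lt_xj jM (leq_trans le_ja) // -siy ltnW.
  exists i; rewrite xiy inE ifN //; exact: contra (@uv _ _) nvbb.
have rbx : rho (b i) = rho x by rewrite (rho_between rxy xiy).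
have nvbb := nv_eq _ _ (esym rbx) nvxx.
have /and4P[/eqP rab _ lt_ab _] := c_cover i.
rewrite inE ifN; last exact: contra (@uv _ _) nvbb.
(* Conversely a separated cut spreads outwards: [W] contains no pair of a nonunderlined class that
   is weakly decreasing in [sigma], so each split has one possible outcome. *)
move=> wab; have /andP[lt_xi le_iy] := xiy; have /orP[wax|wxb] := w_split x wab.
  move: wax; apply: contraLR => _; apply: w_ge; last exact: cover_ge.
    by rewrite rab.
  exact: nv_eq (esym rab) nvbb.
have /orP[//|wyb] := w_split y wxb.
move: wyb; apply: contraLR => _; apply: w_ge => //; first by rewrite -rxy.
exact: nv_eq rxy nvxx.
Qed.

Lemma glued_cuts : glued (cuts W) (fun B => bip_restr (val B) W) = W.
Proof.
set G := glued _ _; apply/setP => -[x y].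
have [lt_xy|lt_yx|rxy] := ltngtP (rho x) (rho y).
- have /andP[-> _] : ((x, y) \in G) && ((y, x) \notin G) by apply: glued_lt.
  have [cW _ _] := elimT (interval_bipP W) WP x y.
  by have /andP[->] := cW lt_xy.
- have /andP[_ /negPf->] : ((y, x) \in G) && ((x, y) \notin G).
    exact: glued_lt.
  have [cW _ _] := elimT (interval_bipP W) WP y x.
  by have /andP[_ /negPf->] := cW lt_yx.
have [uxx|nuxx] := boolP (u x x); first by rewrite glued1 // w_cuts1.
have [vxx|nvxx] := boolP (v x x); last by rewrite glued0 // w_cuts0.
have spx : special x by rewrite vxx.
have [B [s [t [-> ->]]]] := rho_special_block rxy spx.
by rewrite gluedB bip_restrE.
Qed.

End GluedCuts.

End Coordinates.

End RegularInterval.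


(** * Assembly of the isomorphism *)

Lemma poset_isomorphic_can (d1 d2 : Order.disp_t) (P : porderType d1)
    (Q : porderType d2) (f : P -> Q) (g : Q -> P) :
  cancel f g -> cancel g f ->
  {homo f : x y / (x <= y)%O} -> {homo g : x y / (x <= y)%O} ->
  poset_isomorphic P Q.
Proof.
move=> fK gK fh gh; exists f; first by exists g.
by move=> x y; apply/idP/idP => [/gh|/fh//]; rewrite !fK.
Qed.

Theorem proposition10p2 (X : finType) (U V : Bip X)
    (hUV : regular_interval U V) :
  exists (m : nat) (n : 'I_m -> nat) (S : {set {set X}}),
    (forall B : {set X}, B \in S ->
       nonunderlined_block U B /\ underlined_block V B) /\
    poset_isomorphic (interval U V) (boolean_product n *p Bip_product S).
Proof.
have [n [c [c_cover c_inj c_surj]]] := covers_enum hUV.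
(* The bits of all underlined and nonunderlined classes are collected into a single Boolean factor,
   the power set of the [n] cuts. *)
pose k : 'I_1 -> nat := fun=> n.
exists 1, k, (special_blocks U V); split.
  move=> B /imsetP[x]; rewrite inE => /[dup] spx /andP[vxx nuxx] ->.
  have [simU simV] := sim_special hUV spx.
  have := sim_block_mem U x; have := sim_block_mem V x.
  by rewrite vxx (negPf nuxx) simU simV.
pose f (W : interval U V) :
    boolean_product k *p Bip_product (special_blocks U V) :=
  ([ffun=> cuts U c (val W)],
   [ffun B : {B | B \in special_blocks U V} => bip_restr (val B) (val W)]).
pose g (p : boolean_product k *p Bip_product (special_blocks U V)) :
    interval U V :=
  Sub (MkBip (glued_bip hUV c (p.1 ord0) p.2))
      (glued_interval hUV c (p.1 ord0) p.2).
apply: (@poset_isomorphic_can _ _ _ _ f g).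
- case=> W WP; apply/val_inj/val_inj => /=; rewrite ffunE.
  rewrite -[RHS](glued_cuts hUV c_cover c_surj WP).
  by apply: eq_glued => // B; rewrite ffunE.
- case=> M F; congr (_, _); apply/ffunP => i; rewrite ffunE.
    by rewrite (ord1 i); apply: cuts_glued.
  by apply/val_inj/setP => -[s t]; rewrite bip_restrE; apply: gluedB.
- move=> W W'; rewrite leintervalE leBipE => leW.
  rewrite leEprod; apply/andP; split; apply/forallP => i.
    by rewrite !ffunE; exact: cuts_mono.
  rewrite !ffunE leBipE; apply/subsetP => -[s t]; rewrite !bip_restrE.
  exact: subsetP leW (val s, val t).
- move=> [M F] [M' F']; rewrite leEprod => /andP[/forallP leM /forallP leF].
  by rewrite leintervalE leBipE; apply: glued_mono; [apply: (leM ord0)|].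
Qed.
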